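(* For every integer $n\ge 5$, $\overrightarrow{\beta}(K_n,1)=n-3$, where $K_n$ is the complete graph on $n$ vertices.
   Context: Firefighting on oriented graphs: an orientation $\overrightarrow{G}$ of a finite simple graph $G$ replaces each edge $uv$ by exactly one of the arcs $\overrightarrow{uv}$, $\overrightarrow{vu}$. Let $f\ge 1$ be an integer. A fire breaks out at a vertex $v$ at time $1$ ($v$ burns). At the end of each time unit, the firefighters permanently protect up to $f$ vertices that are neither burning nor already protected. At the next time unit, every vertex that is neither burning nor protected and is an out-neighbour of a burning vertex starts to burn. The process ends when no new vertex can burn. $\beta(\overrightarrow{G},f)$ is the maximum, over all starting vertices $v$, of the minimum, over all protection strategies, of the number of vertices that burn. $\overrightarrow{\beta}(G,f)$ is the minimum of $\beta(\overrightarrow{G},f)$ over all orientations $\overrightarrow{G}$ of $G$. *)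

(* Defs.v *)
From mathcomp Require Import all_boot.

Set Implicit Arguments.
Unset Strict Implicit.
Unset Printing Implicit Defensive.

Record sgraph (T : finType) := SGraph {
  edge :> rel T;
  edge_sym : symmetric edge;
  edge_irr : irreflexive edge
}.

Section Complete.
Variable T : finType.
Definition neq_rel : rel T := [rel x y | x != y].
Lemma neq_rel_sym : symmetric neq_rel.
Proof. by move=> x y; rewrite /neq_rel /= eq_sym. Qed.
Lemma neq_rel_irr : irreflexive neq_rel.
Proof. by move=> x; rewrite /neq_rel /= eqxx. Qed.
Definition complete : sgraph T := SGraph neq_rel_sym neq_rel_irr.
End Complete.

Notation "''K_' n" := (complete 'I_n) (at level 8, n at level 2, format "''K_' n").

Section Firefighting.
Variable T : finType.

(* An oriented graph is given by its set of arcs, (x, y) being the arc from x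
   to y. *)
Definition orientation (G : sgraph T) (D : {set T * T}) : bool :=
  [forall x, forall y,
     if G x y then ((x, y) \in D) (+) ((y, x) \in D) else (x, y) \notin D].

(* S t is the set of vertices protected at the end of time unit t + 1. *)
Definition protected (S : nat -> {set T}) (t : nat) : {set T} :=
  \bigcup_(s < t) S s.

(* burning D v S t is the set of vertices burning at time unit t + 1. *)
Fixpoint burning (D : {set T * T}) (v : T) (S : nat -> {set T}) (t : nat)
    : {set T} :=
  if t is t'.+1 then
    burning D v S t' :|:
      [set y | (y \notin protected S t) &&
               [exists x in burning D v S t', (x, y) \in D]]
  else [set v].

(* The burning set has at least one element at the start and is constant as soon
   as it fails to grow once, so that the process is over after #|T| time units:
   this is why strategies of length #|T| are enough. *)
Lemma burning_stable D v S t : #|T| <= t.+1 ->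
  burning D v S t.+1 = burning D v S t.
Proof.
have stop u : burning D v S u.+1 = burning D v S u ->
    burning D v S u.+2 = burning D v S u.+1.
  move=> E; apply/eqP; rewrite eqEsubset subsetUl andbT.
  rewrite [burning D v S u.+2]/= -/(burning D v S u.+1) subUset subxx /=.
  apply/subsetP=> y; rewrite inE => /andP[Py] yD.
  rewrite -[_ :|: _]/(burning D v S u.+1) E in yD.
  rewrite !inE yD andbT; apply/orP; right.
  apply: contra Py; rewrite /protected [in X in _ -> X]big_ord_recr inE /=.
  by move=> ->.
have grow u : burning D v S u.+1 = burning D v S u
            \/ u.+1 < #|burning D v S u.+1|.
  elim: u => [|u [/stop|IH]]; [|by left|].
    have [->|NE] := eqVneq (burning D v S 1) (burning D v S 0); first by left.
    right; rewrite -[X in X < _](cards1 v) -[[set v]]/(burning D v S 0).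
    apply: proper_card.
    by rewrite properEneq eq_sym NE subsetUl.
  have [->|NE] := eqVneq (burning D v S u.+2) (burning D v S u.+1).
    by left.
  right; apply: leq_ltn_trans IH _; apply: proper_card.
  by rewrite properEneq eq_sym NE subsetUl.
move=> leTt; case: (grow t) => // lt; have := max_card (mem (burning D v S t.+1)).
by move/(leq_trans lt)/leq_trans/(_ leTt); rewrite ltnn.
Qed.

Definition strategy := #|T|.-tuple {set T}.

Definition moves (S : strategy) : nat -> {set T} := nth set0 S.

Definition legal (D : {set T * T}) (f : nat) (v : T) (S : strategy) : bool :=
  [forall t : 'I_#|T|,
     (#|moves S t| <= f) &&
     [disjoint moves S t & burning D v (moves S) t :|: protected (moves S) t]].

Definition burnt (D : {set T * T}) (v : T) (S : strategy) : {set T} :=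
  burning D v (moves S) #|T|.

(* In the two minima below, the default value #|T| of the big operator is an
   upper bound of all the terms, and the range is never empty. *)
Definition burn_number_at (D : {set T * T}) (f : nat) (v : T) : nat :=
  \big[minn/#|T|]_(S : strategy | legal D f v S) #|burnt D v S|.

Definition burn_number (D : {set T * T}) (f : nat) : nat :=
  \max_(v : T) burn_number_at D f v.

Definition oriented_burn_number (G : sgraph T) (f : nat) : nat :=
  \big[minn/#|T|]_(D : {set T * T} | orientation G D) burn_number D f.

End Firefighting.

(* Main.v *)
(* Lower bound: start the fire at a vertex v of maximum out-degree d.  One time
   unit later at least d vertices burn, and an unprotected vertex u that does
   not catch fire next must dominate all of them; hence N+(u) is exactly this
   burning set.  Two such vertices are joined by an arc, so one would lie in the
   out-neighbourhood of the other, i.e. burn.  So at most one vertex survives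
   besides the first two protected ones.

   Upper bound: let k = (n - 1) / 2 (rounded down).  Take the circulant
   tournament on 0, ..., 2k, where i < j is oriented from i to j iff j <= i + k,
   with the sink 2k + 1 added if n is even.  From any v other than the sink, a
   vertex w is dominated by no vertex of N+[v] except possibly a single p in
   N+(v), and some x lies outside N+[v] besides w; protecting p, x, w in this
   order is legal. *)
Require Import Defs.
From mathcomp Require Import all_boot zify.

Set Implicit Arguments.
Unset Strict Implicit.
Unset Printing Implicit Defensive.

Lemma geq_bigminn (I : eqType) (r : seq I) (P : pred I) (F : I -> nat) x0 i :
  i \in r -> P i -> \big[minn/x0]_(j <- r | P j) F j <= F i.
Proof.
elim: r => // j r IH; rewrite inE big_cons => /predU1P[<- Pi|ir Pi].
  by rewrite Pi geq_minl.
by case: (P j); rewrite ?(leq_trans (geq_minr _ _)) // IH.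
Qed.

Lemma leq_bigminn (I : Type) (r : seq I) (P : pred I) (F : I -> nat) x0 m :
  m <= x0 -> (forall i, P i -> m <= F i) ->
  m <= \big[minn/x0]_(j <- r | P j) F j.
Proof.
by move=> m0 mF; apply: (big_ind (leq m)) => // x y mx my; rewrite leq_min mx.
Qed.

Section Burning.
Variables (T : finType) (D : {set T * T}).
Implicit Types (v x y : T) (S : nat -> {set T}) (t : nat).

Lemma mem_protected S s t y : s < t -> y \in S s -> y \in protected S t.
Proof. by move=> st yS; apply/bigcupP; exists (Ordinal st). Qed.

Lemma protectedS S t : protected S t.+1 = protected S t :|: S t.
Proof. exact: big_ord_recr. Qed.

Lemma in_burningS v S t y :
  (y \in burning D v S t.+1) =
  (y \in burning D v S t) ||
  ((y \notin protected S t.+1) && [exists x in burning D v S t, (x, y) \in D]).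
Proof. by rewrite [burning _ _ _ _]/= !inE. Qed.

Lemma burning_mono v S t u :
  t <= u -> burning D v S t \subset burning D v S u.
Proof.
elim: u => [|u IH]; first by rewrite leqn0 => /eqP->.
rewrite leq_eqVlt => /predU1P[->//|/IH tu].
by apply: subset_trans tu _; apply: subsetUl.
Qed.

(** Protection is permanent, so from stage [s] on it blocks the only rule by which [y] could ignite.
    The index [s.+1] takes in the move [S s], made while stage [s] burns. *)
Lemma notin_burning_protected v S s t y : s <= t ->
  y \in protected S s.+1 -> y \notin burning D v S s ->
  y \notin burning D v S t.
Proof.
move=> + /bigcupP[[i /= ilt] _ yi] yB.
elim: t => [|t IH]; first by rewrite leqn0 => /eqP <-.
rewrite leq_eqVlt => /predU1P[<-//|st].
rewrite in_burningS negb_or IH //= negb_and negbK.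
by rewrite (@mem_protected S i t.+1) // (leq_trans ilt) // ltnW.
Qed.

Definition outset x := [set y | (x, y) \in D].

End Burning.

Section LowerBound.
Variables (T : finType) (D : {set T * T}).
Hypothesis oD : orientation (complete T) D.

Lemma tournament_irr x : (x, x) \notin D.
Proof. by move/forallP/(_ x)/forallP/(_ x): oD; rewrite edge_irr. Qed.

Lemma tournament_total x y : x != y -> ((x, y) \in D) || ((y, x) \in D).
Proof.
move=> xy; move/forallP/(_ x)/forallP/(_ y): oD.
by rewrite [complete T x y]xy; do 2!case: (_ \in D).
Qed.

Lemma burnt_from_max_outdegree v (S : strategy T) : 1 < #|T| ->
  (forall u, #|outset D u| <= #|outset D v|) -> legal D 1 v S ->
  #|T| - 3 <= #|burnt D v S|.
Proof.
move=> T2 vmax /forallP lS; set M := moves S in lS *.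
have M01 : #|M 0| <= 1 by case/andP: (lS (Ordinal (ltnW T2))).
have M11 : #|M 1| <= 1 by case/andP: (lS (Ordinal T2)).
have vM0 : v \notin M 0.
  case/andP: (lS (Ordinal (ltnW T2))) => _ /= /disjointFl ->//.
  by rewrite !inE eqxx.
pose B1 := burning D v M 1; pose B2 := burning D v M 2.
have P1 : protected M 1 = M 0 by rewrite protectedS /protected big_ord0 set0U.
have P2 : protected M 2 = M 0 :|: M 1 by rewrite protectedS P1.
have B12 : B1 \subset B2 by apply: burning_mono.
(* The first move removes at most one vertex from the closed out-neighbourhood of [v], and [v]
   itself makes up for that loss. *)
have cB1 : #|outset D v| <= #|B1|.
  have sub : (v |: outset D v) :\: M 0 \subset B1.
    apply/subsetP=> y; rewrite /B1 in_burningS P1 !inE => /andP[-> /orP[->//|vy]].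
    by apply/orP; right; apply/existsP; exists v; rewrite !inE eqxx.
  apply: leq_trans (subset_leq_card sub).
  have := cardsD (v |: outset D v) (M 0); rewrite cardsU1 inE tournament_irr /=.
  by have := subset_leq_card (subsetIr (v |: outset D v) (M 0)); lia.
pose U := ~: (B2 :|: (M 0 :|: M 1)).
have outU u : u \in U -> outset D u = B1.
  rewrite in_setC in_setU => /norP[uB2 uM]; apply/esym/eqP.
  (* Maximality of the out-degree of [v] bounds [outset D u] by the size of [B1], so only the
     inclusion of [B1] remains to be shown. *)
  rewrite eqEcard (leq_trans (vmax u) cB1) andbT.
  apply/subsetP=> b bB1; rewrite inE.
  have bu : b != u by apply: contraNneq uB2 => <-; apply: (subsetP B12).
  case/orP: (tournament_total bu) => // bu'.
  case/negP: uB2; rewrite /B2 in_burningS P2 uM /=.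
  by apply/orP; right; apply/existsP; exists b; rewrite bB1.
have UnB1 u : u \in U -> u \notin B1.
  by rewrite in_setC; apply: contra => uB1; rewrite in_setU (subsetP B12).
have U1 : #|U| <= 1.
  apply/card_le1_eqP=> u' u u'U uU; apply/eqP; apply: contraT => uu'.
  case/orP: (tournament_total uu') => a.
    by have := UnB1 _ u'U; rewrite -(outU _ uU) inE a.
  by have := UnB1 _ uU; rewrite -(outU _ u'U) inE a.
have B2le : #|B2| <= #|burnt D v S| by apply/subset_leq_card/burning_mono.
have := cardsC (B2 :|: (M 0 :|: M 1)); rewrite -/U.
have [+ _] := leq_card_setU B2 (M 0 :|: M 1).
have [+ _] := leq_card_setU (M 0) (M 1); lia.
Qed.

Lemma leq_burn_number_tournament : 1 < #|T| -> #|T| - 3 <= burn_number D 1.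
Proof.
move=> T2; have /card_gt0P[v0 _] := ltnW T2.
have [v _ vmax] := @arg_maxnP _ v0 predT (fun u => #|outset D u|) isT.
apply: leq_trans (leq_bigmax v).
apply: leq_bigminn => [|S lS]; first exact: leq_subr.
by apply: burnt_from_max_outdegree lS => // u; apply: vmax.
Qed.

End LowerBound.

Section UpperBound.
Variables (T : finType) (D : {set T * T}).

(** The fire needs at least two steps to reach [x], so [x] can wait for the second move. It could
    reach [w] in two steps only through [p]; once [p] is protected, [w] can wait for the third. *)
Lemma burn_number_at_save3 (v p x w : T) : 2 < #|T| ->
  uniq [:: v; p; x; w] -> x \notin outset D v -> w \notin outset D v ->
  (forall y, y \in outset D v -> (y, w) \in D -> y = p) ->
  burn_number_at D 1 v <= #|T| - 3.
Proof.
move=> T3 /= /and4P[].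
rewrite !inE => /norP[vp /norP[vx vw]] /norP[px pw] xw _ xv wv yw.
(* Empty moves pad the strategy to its fixed length [#|T|]. *)
pose s := [:: [set p]; [set x]; [set w]] ++ nseq (#|T| - 3) set0.
have ss : size s == #|T| by rewrite size_cat size_nseq subnKC.
pose S : strategy T := Tuple ss; pose M := moves S.
have M3 t : M t.+3 = set0.
  by rewrite /M /moves /= nth_nseq; case: ifP.
have B1 : {subset burning D v M 1 <=
    [pred y | (y == v) || (y \in outset D v) && (y != p)]}.
  move=> y; rewrite in_burningS protectedS !inE => /orP[->//|/andP[yp]].
  case/existsP=> u; rewrite !inE => /andP[/eqP-> ->].
  by case/norP: yp => _ ->; rewrite orbT.
have pB1 : p \notin burning D v M 1.
  by apply/negP=> /B1; rewrite !inE eq_sym (negPf vp) eqxx andbF.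
have xB1 : x \notin burning D v M 1.
  by apply/negP=> /B1; rewrite !inE eq_sym (negPf vx) (negPf xv).
have wB2 : w \notin burning D v M 2.
  rewrite in_burningS negb_or; apply/andP; split.
    by apply/negP=> /B1; rewrite !inE eq_sym (negPf vw) (negPf wv).
  rewrite negb_and; apply/orP; right; apply/existsP=> -[u /andP[/B1]].
  rewrite inE => /orP[/eqP->|/andP[uv up] uw]; first by rewrite (negPf wv).
  by rewrite (yw u) ?eqxx in up.
have lS : legal D 1 v S.
  apply/forallP=> -[[|[|[|t]]] lt] /=; rewrite -/M; last first.
  - by rewrite M3 cards0 disjoints_subset sub0set.
  - rewrite /M {1 2}/moves /= cards1 disjoints1 -/M inE (negPf wB2) /=.
    by rewrite 2!protectedS /protected big_ord0 !inE eq_sym (negPf pw) eq_sym.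
  - rewrite /M {1 2}/moves /= cards1 disjoints1 -/M inE [_ \in _ :|: _](negPf xB1) /=.
    by rewrite protectedS /protected big_ord0 !inE eq_sym.
  - rewrite /M {1 2}/moves /= cards1 disjoints1 /protected big_ord0 !inE.
    by rewrite eq_sym (negPf vp).
apply: leq_trans (geq_bigminn _ _ (mem_index_enum S) lS) _.
have saved : [set p; x; w] \subset ~: burnt D v S.
  apply/subsetP=> y; rewrite !inE -orbA => /or3P[] /eqP->.
  - apply: notin_burning_protected pB1; first lia.
    by apply: (@mem_protected _ _ 0) => //; rewrite inE.
  - apply: notin_burning_protected xB1; first lia.
    by apply: (@mem_protected _ _ 1) => //; rewrite inE.
  - apply: notin_burning_protected wB2; first lia.
    by apply: (@mem_protected _ _ 2) => //; rewrite inE.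
have := subset_leq_card saved; have := cardsC (burnt D v S).
by rewrite setUC cardsU1 cards2 !inE px negb_or eq_sym pw eq_sym xw /=; lia.
Qed.

End UpperBound.

(** The value [k.*2.+1] is an index only for even [n], where it is the sink; for odd [n] both tests
    against it are vacuous, so one formula serves both parities. *)
Definition circular_tournament n : {set 'I_n * 'I_n} :=
  let k := n.-1./2 in
  [set a : 'I_n * 'I_n |
     (a.1 < a.2) && ((a.2 <= a.1 + k) || (a.2 == k.*2.+1 :> nat)) ||
     (a.2 + k < a.1) && (a.1 != k.*2.+1 :> nat)].

(** For [i < j], the condition for the backward arc is the exact negation of that for the forward
    arc. *)
Lemma circular_tournamentP n : orientation 'K_n (circular_tournament n).
Proof.
apply/forallP=> x; apply/forallP=> y; rewrite !inE /=.
rewrite -[neq_rel _ _]/(x != y :> nat).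
by case: ifP; lia.
Qed.

Lemma burn_number_circular_tournament n : 5 <= n ->
  burn_number (circular_tournament n) 1 <= n - 3.
Proof.
move=> hn; apply/bigmax_leqP=> -[v vn] _; set k := n.-1./2.
(* Modulo 2k+1, a non-sink [v] dominates v+1, ..., v+k on the cycle, and [w] = v-1 is dominated
   there by v+k, ..., v-2; the two ranges share only [p] = v+k. The vertex [x] is v-2, or v+k+1 when
   v-2 would be negative. As [n] is at least 5, [k] is at least 2, which keeps [p], [x], [w]
   distinct and [x] outside the out-neighbourhood. For the sink, which has no out-neighbours, the
   same formulas still give distinct vertices. *)
pose p := if v <= k then v + k else v - k.+1.
pose w := if v == 0 then k.*2 else v.-1.
pose x := if v <= 1 then v + k.+1 else v - 2.
have pn : p < n by rewrite /p; case: ifP; lia.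
have wn : w < n by rewrite /w; case: ifP; lia.
have xn : x < n by rewrite /x; case: ifP; lia.
rewrite -[X in _ <= X - _]card_ord.
apply: (@burn_number_at_save3 _ _ _ (Ordinal pn) (Ordinal xn) (Ordinal wn)).
- by rewrite card_ord; lia.
- rewrite /= !inE -!val_eqE /= /p /x /w.
  by case: (leqP v k); case: (leqP v 1); case: (eqVneq v 0); lia.
- by rewrite !inE /= -/k /x; case: (leqP v 1); lia.
- by rewrite !inE /= -/k /w; case: (eqVneq v 0); lia.
- move=> y; rewrite !inE /= -/k => vy yw; apply: val_inj => /=.
  have := ltn_ord y; move: vy yw; rewrite /p /w.
  by case: (leqP v k); case: (eqVneq v 0); lia.
Qed.

Theorem theorem3p5 (n : nat) (hn : 5 <= n) :
  oriented_burn_number 'K_n 1 = n - 3.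
Proof.
apply/eqP; rewrite eqn_leq; apply/andP; split.
  apply: leq_trans (burn_number_circular_tournament hn).
  by apply: geq_bigminn; [apply: mem_index_enum | apply: circular_tournamentP].
apply: leq_bigminn => [|D oD]; first by rewrite card_ord leq_subr.
rewrite -[X in X - _](card_ord n).
by apply: leq_burn_number_tournament => //; rewrite card_ord; lia.
Qed.
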